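(* Let $K$ be a field, $P_0=K[x_1,\dots,x_m]$, $P=P_0[y_1,\dots,y_n]$ bigraded by $\deg x_i=(1,0)$, $\deg y_j=(0,1)$, and $P_+=(y_1,\dots,y_n)$. Let $f\in P$ be a bihomogeneous polynomial and let $R=P/fP$. Then $$\operatorname{Hilb}\big(H^n_{P_+}(R)_{j-1}\big)\ \ge\ \operatorname{Hilb}\big(H^n_{P_+}(R)_{j}\big)\qquad\text{for all } j\le -n .$$
   Context: For a bigraded $P$-module $N$, $N_j=\bigoplus_i N_{(i,j)}$ is a graded $P_0$-module with $(N_j)_i=N_{(i,j)}$. $H^n_{P_+}(R)$ is local cohomology with its natural bigrading; each $H^n_{P_+}(R)_j$ is a finitely generated graded $P_0$-module. For a finitely generated graded $P_0$-module $M$, $\operatorname{Hilb}(M)=\sum_{i\in\mathbb Z}\dim_K M_i\,t^i$; one writes $\operatorname{Hilb}(M)\le \operatorname{Hilb}(N)$ if $\dim_K M_i\le\dim_K N_i$ for all $i$. *)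

(* Defs.v *)
From HB Require Import structures.
From mathcomp Require Import all_boot all_order all_algebra.
From mathcomp Require Import boolp classical_sets.
From mathcomp Require Import mpoly ring.

Set Implicit Arguments.
Unset Strict Implicit.
Unset Printing Implicit Defensive.

Import Order.TTheory GRing.Theory Num.Theory.
Local Open Scope ring_scope.
Local Open Scope quotient_scope.

Section QuotientModule.
Variables (A : nzRingType) (V : lmodType A) (U : submodClosed V).

Lemma submod_opp x : x \in U -> - x \in U.
Proof. by move=> Ux; rewrite -scaleN1r rpredZ. Qed.

Definition modq_rel (x y : V) : bool := x - y \in U.

Lemma modq_rel_refl : reflexive modq_rel.
Proof. by move=> x; rewrite /modq_rel subrr rpred0. Qed.

Lemma modq_rel_sym : ssrbool.symmetric modq_rel.
Proof.
by move=> x y; apply/idP/idP=> /submod_opp; rewrite opprB.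
Qed.

Lemma modq_rel_trans : transitive modq_rel.
Proof.
by move=> y x z xy yz; rewrite /modq_rel -(subrK y x) -addrA; apply: rpredD.
Qed.

Canonical modq_equiv :=
  EquivRel modq_rel modq_rel_refl modq_rel_sym modq_rel_trans.

Definition modquot : Type := {eq_quot modq_equiv}.
HB.instance Definition _ := EqQuotient.on modquot.
HB.instance Definition _ := Choice.on modquot.

Definition modq_pi (x : V) : modquot := \pi_modquot x.

Lemma modq_piP (x y : V) : (modq_pi x = modq_pi y) <-> (x - y \in U).
Proof. by split=> [/eqmodP|xy] //; apply/eqmodP. Qed.

Lemma modq_reprK (q : modquot) : modq_pi (repr q) = q.
Proof. exact: reprK. Qed.

Definition modq_zero := modq_pi 0.
Definition modq_opp (q : modquot) := modq_pi (- repr q).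
Definition modq_add (q r : modquot) := modq_pi (repr q + repr r).
Definition modq_scale (a : A) (q : modquot) := modq_pi (a *: repr q).

Lemma modq_repr (x : V) : repr (modq_pi x) - x \in U.
Proof. by apply/modq_piP; rewrite modq_reprK. Qed.

Lemma modq_oppE x : modq_opp (modq_pi x) = modq_pi (- x).
Proof. by apply/modq_piP; rewrite -opprD submod_opp ?modq_repr. Qed.

Lemma modq_addE x y : modq_add (modq_pi x) (modq_pi y) = modq_pi (x + y).
Proof. by apply/modq_piP; rewrite opprD addrACA rpredD ?modq_repr. Qed.

Lemma modq_scaleE a x : modq_scale a (modq_pi x) = modq_pi (a *: x).
Proof. by apply/modq_piP; rewrite -scalerBr rpredZ ?modq_repr. Qed.

Lemma modq_ind (P : modquot -> Prop) :
  (forall x, P (modq_pi x)) -> forall q, P q.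
Proof. by move=> h q; rewrite -(modq_reprK q). Qed.

Fact modq_addA : associative modq_add.
Proof.
elim/modq_ind=> x; elim/modq_ind=> y; elim/modq_ind=> z.
by rewrite !modq_addE addrA.
Qed.

Fact modq_addC : commutative modq_add.
Proof. by elim/modq_ind=> x; elim/modq_ind=> y; rewrite !modq_addE addrC. Qed.

Fact modq_add0 : left_id modq_zero modq_add.
Proof. by elim/modq_ind=> x; rewrite modq_addE add0r. Qed.

Fact modq_addN : left_inverse modq_zero modq_opp modq_add.
Proof. by elim/modq_ind=> x; rewrite modq_oppE modq_addE addNr. Qed.

HB.instance Definition _ :=
  GRing.isZmodule.Build modquot modq_addA modq_addC modq_add0 modq_addN.

Lemma modqDE (q r : modquot) : q + r = modq_add q r.
Proof. by []. Qed.

Fact modq_scaleA a b q : modq_scale a (modq_scale b q) = modq_scale (a * b) q.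
Proof. by elim/modq_ind: q => x; rewrite !modq_scaleE scalerA. Qed.

Fact modq_scale1 : left_id 1 modq_scale.
Proof. by elim/modq_ind=> x; rewrite modq_scaleE scale1r. Qed.

Fact modq_scaleDr : right_distributive modq_scale +%R.
Proof.
move=> a; elim/modq_ind=> x; elim/modq_ind=> y.
by rewrite !modqDE modq_addE !modq_scaleE modq_addE scalerDr.
Qed.

Fact modq_scaleDl q : {morph modq_scale^~ q : a b / a + b}.
Proof.
elim/modq_ind: q => x a b.
by rewrite modqDE !modq_scaleE modq_addE scalerDl.
Qed.

HB.instance Definition _ := GRing.Zmodule_isLmodule.Build A modquot
  modq_scaleA modq_scale1 modq_scaleDr modq_scaleDl.

Fact modq_pi_is_linear : linear modq_pi.
Proof.
move=> a x y.
by rewrite modqDE [in RHS]/GRing.scale /= modq_scaleE modq_addE.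
Qed.

HB.instance Definition _ := GRing.isLinear.Build A V modquot *:%R modq_pi
  modq_pi_is_linear.

End QuotientModule.

(* Localization W^-1 M of a module M at a multiplicative subset W. *)
Section Localization.
Variables (A : comNzRingType) (W : mulrClosed A) (M : lmodType A).

Let den := {w : A | w \in W}.

Definition loc_rel (p q : M * den) : bool :=
  `[< exists u, u \in W /\ u *: (sval q.2 *: p.1) = u *: (sval p.2 *: q.1) >].

Lemma loc_rel_refl : reflexive loc_rel.
Proof. by move=> p; apply/asboolP; exists 1; rewrite rpred1. Qed.

Lemma loc_rel_sym : ssrbool.symmetric loc_rel.
Proof.
by move=> p q; apply/asboolP/asboolP=> -[u [uW e]]; exists u; split.
Qed.

Lemma loc_rel_trans : transitive loc_rel.
Proof.
move=> [b [v vW]] [a [u uW]] [c [w wW]] /asboolP[s [sW /= es]].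
move=> /asboolP[t [tW /= et]]; apply/asboolP; exists (s * t * v) => /=.
split; first by rewrite !rpredM.
rewrite !scalerA in es et *.
have -> : s * t * v * w = (t * w) * (s * v) by ring.
rewrite -scalerA es scalerA.
have -> : t * w * (s * u) = (s * u) * (t * w) by ring.
by rewrite -scalerA et scalerA; congr (_ *: _); ring.
Qed.

Canonical loc_equiv := EquivRel loc_rel loc_rel_refl loc_rel_sym loc_rel_trans.

Definition loc : Type := {eq_quot loc_equiv}.
HB.instance Definition _ := EqQuotient.on loc.
HB.instance Definition _ := Choice.on loc.

Definition loc_frac (a : M) (w : den) : loc := \pi_loc (a, w).

Lemma loc_fracP a b (v w : den) :
  loc_frac a v = loc_frac b w <->
  exists u, u \in W /\ u *: (sval w *: a) = u *: (sval v *: b).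
Proof. by split=> [/eqmodP/asboolP|h] //; apply/eqmodP/asboolP. Qed.

Lemma loc_ind (P : loc -> Prop) :
  (forall a w, P (loc_frac a w)) -> forall q, P q.
Proof.
by move=> h q; rewrite -(reprK q); case: (repr q) => a w; apply: h.
Qed.

Definition den1 : den := exist _ 1 (rpred1 W).
Definition denM (v w : den) : den :=
  exist _ (sval v * sval w) (rpredM (valP v) (valP w)).

Definition loc_num (q : loc) : M := (repr q).1.
Definition loc_den (q : loc) : den := (repr q).2.

Lemma loc_fracK q : loc_frac (loc_num q) (loc_den q) = q.
Proof. by rewrite /loc_frac -surjective_pairing reprK. Qed.

Definition loc_zero := loc_frac 0 den1.
Definition loc_opp (q : loc) := loc_frac (- loc_num q) (loc_den q).
Definition loc_add (q r : loc) :=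
  loc_frac (val (loc_den r) *: loc_num q + val (loc_den q) *: loc_num r)
           (denM (loc_den q) (loc_den r)).
Definition loc_scale (a : A) (q : loc) := loc_frac (a *: loc_num q) (loc_den q).

Lemma loc_oppE a v : loc_opp (loc_frac a v) = loc_frac (- a) v.
Proof.
have /loc_fracP[u [uW e]] := loc_fracK (loc_frac a v).
by apply/loc_fracP; exists u; rewrite !scalerN e.
Qed.

Lemma loc_scaleE c a v : loc_scale c (loc_frac a v) = loc_frac (c *: a) v.
Proof.
have /loc_fracP[u [uW e]] := loc_fracK (loc_frac a v).
apply/loc_fracP; exists u; split=> //.
have swap (z : A) (x : M) : u *: (z *: (c *: x)) = c *: (u *: (z *: x)).
  by rewrite !scalerA; congr (_ *: _); ring.
by rewrite !swap e.
Qed.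

Lemma loc_addE a b v w : loc_add (loc_frac a v) (loc_frac b w) =
  loc_frac (sval w *: a + sval v *: b) (denM v w).
Proof.
have /loc_fracP[s [sW es]] := loc_fracK (loc_frac a v).
have /loc_fracP[t [tW et]] := loc_fracK (loc_frac b w).
rewrite /loc_add; move: es et.
move: (loc_num _) (loc_den _) (loc_num _) (loc_den _) => b' w' a' v' es et.
apply/loc_fracP; exists (s * t); rewrite rpredM //; split=> //=.
rewrite !scalerDr !scalerA; rewrite !scalerA in es et.
congr (_ + _).
- transitivity ((t * sval w * sval w') *: ((s * sval v) *: a')).
    by rewrite scalerA; congr (_ *: _); ring.
  by rewrite es scalerA; congr (_ *: _); ring.
- transitivity ((s * sval v * sval v') *: ((t * sval w) *: b')).
    by rewrite scalerA; congr (_ *: _); ring.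
  by rewrite et scalerA; congr (_ *: _); ring.
Qed.

Fact loc_addA : associative loc_add.
Proof.
elim/loc_ind=> a u; elim/loc_ind=> b v; elim/loc_ind=> c w.
rewrite !loc_addE; apply/loc_fracP; exists 1; rewrite rpred1; split=> //=.
rewrite !scalerDr !scalerA addrA.
by congr (_ *: _ + _ *: _ + _ *: _); ring.
Qed.

Fact loc_addC : commutative loc_add.
Proof.
elim/loc_ind=> a u; elim/loc_ind=> b v; rewrite !loc_addE.
apply/loc_fracP; exists 1; rewrite rpred1; split=> //=.
by rewrite addrC [sval v * _]mulrC.
Qed.

Fact loc_add0 : left_id loc_zero loc_add.
Proof.
elim/loc_ind=> a u; rewrite loc_addE; apply/loc_fracP; exists 1.
by rewrite rpred1; split=> //=; rewrite scaler0 add0r !scale1r mul1r.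
Qed.

Fact loc_addN : left_inverse loc_zero loc_opp loc_add.
Proof.
elim/loc_ind=> a u; rewrite loc_oppE loc_addE; apply/loc_fracP; exists 1.
by rewrite rpred1; split=> //=; rewrite scalerN addNr !scaler0.
Qed.

HB.instance Definition _ :=
  GRing.isZmodule.Build loc loc_addA loc_addC loc_add0 loc_addN.

Lemma locDE (q r : loc) : q + r = loc_add q r.
Proof. by []. Qed.

Fact loc_scaleA a b q : loc_scale a (loc_scale b q) = loc_scale (a * b) q.
Proof. by elim/loc_ind: q => x w; rewrite !loc_scaleE scalerA. Qed.

Fact loc_scale1 : left_id 1 loc_scale.
Proof. by elim/loc_ind=> x w; rewrite loc_scaleE scale1r. Qed.

Fact loc_scaleDr : right_distributive loc_scale +%R.
Proof.
move=> a; elim/loc_ind=> x u; elim/loc_ind=> y v.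
rewrite !locDE loc_addE !loc_scaleE loc_addE.
apply/loc_fracP; exists 1; rewrite rpred1; split=> //=.
by rewrite !scalerDr !scalerA; congr (_ *: _ + _ *: _); ring.
Qed.

Fact loc_scaleDl q : {morph loc_scale^~ q : a b / a + b}.
Proof.
elim/loc_ind: q => x u a b.
rewrite locDE !loc_scaleE loc_addE.
apply/loc_fracP; exists 1; rewrite rpred1; split=> //=.
by rewrite !scalerDr !scalerA -scalerDl; congr (_ *: _); ring.
Qed.

HB.instance Definition _ := GRing.Zmodule_isLmodule.Build A loc
  loc_scaleA loc_scale1 loc_scaleDr loc_scaleDl.

Lemma loc_addfE a b v w : loc_frac a v + loc_frac b w =
  loc_frac (sval w *: a + sval v *: b) (denM v w).
Proof. exact: loc_addE. Qed.

Lemma loc_scalefE c a v : c *: loc_frac a v = loc_frac (c *: a) v.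
Proof. exact: loc_scaleE. Qed.

End Localization.

Section LocalizationMap.
Variables (A : comNzRingType) (M : lmodType A).
Variables (W1 W2 : mulrClosed A) (sW : {subset W1 <= W2}).

Definition den_map (w : {w : A | w \in W1}) : {w : A | w \in W2} :=
  exist _ (sval w) (sW (valP w)).

Definition loc_map (q : loc W1 M) : loc W2 M :=
  loc_frac (loc_num q) (den_map (loc_den q)).

Lemma loc_mapE (a : M) (w : {w : A | w \in W1}) :
  loc_map (loc_frac a w) = loc_frac a (den_map w).
Proof.
have /loc_fracP[u [uW e]] := loc_fracK (loc_frac a w).
by apply/loc_fracP; exists u; split=> //=; apply: sW.
Qed.

Fact loc_map_is_linear : linear loc_map.
Proof.
move=> c; elim/loc_ind=> a v; elim/loc_ind=> b w.
rewrite loc_scalefE loc_addfE !loc_mapE loc_scalefE loc_addfE.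
by apply/loc_fracP; exists 1; rewrite rpred1.
Qed.

HB.instance Definition _ := GRing.isLinear.Build A _ _ *:%R loc_map
  loc_map_is_linear.

End LocalizationMap.

Section DependentProduct.
Variables (A : nzRingType) (I : finType) (V : I -> lmodType A).

Definition dprod : Type := {dffun forall i, V i}.
HB.instance Definition _ := Choice.on dprod.

Implicit Types c d : dprod.

Definition dprod_zero : dprod := [ffun i => 0 : V i].
Definition dprod_opp c : dprod := [ffun i => - c i : V i].
Definition dprod_add c d : dprod := [ffun i => c i + d i : V i].
Definition dprod_scale a c : dprod := [ffun i => a *: c i : V i].

Fact dprod_addA : associative dprod_add.
Proof. by move=> c d e; apply/ffunP=> i; rewrite !ffunE addrA. Qed.
Fact dprod_addC : commutative dprod_add.
Proof. by move=> c d; apply/ffunP=> i; rewrite !ffunE addrC. Qed.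
Fact dprod_add0 : left_id dprod_zero dprod_add.
Proof. by move=> c; apply/ffunP=> i; rewrite !ffunE add0r. Qed.
Fact dprod_addN : left_inverse dprod_zero dprod_opp dprod_add.
Proof. by move=> c; apply/ffunP=> i; rewrite !ffunE addNr. Qed.

HB.instance Definition _ :=
  GRing.isZmodule.Build dprod dprod_addA dprod_addC dprod_add0 dprod_addN.

Fact dprod_scaleA a b c : dprod_scale a (dprod_scale b c) = dprod_scale (a * b) c.
Proof. by apply/ffunP=> i; rewrite !ffunE scalerA. Qed.
Fact dprod_scale1 : left_id 1 dprod_scale.
Proof. by move=> c; apply/ffunP=> i; rewrite !ffunE scale1r. Qed.
Fact dprod_scaleDr : right_distributive dprod_scale +%R.
Proof. by move=> a c d; apply/ffunP=> i; rewrite !ffunE scalerDr. Qed.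
Fact dprod_scaleDl c : {morph dprod_scale^~ c : a b / a + b}.
Proof. by move=> a b; apply/ffunP=> i; rewrite !ffunE scalerDl. Qed.

HB.instance Definition _ := GRing.Zmodule_isLmodule.Build A dprod
  dprod_scaleA dprod_scale1 dprod_scaleDr dprod_scaleDl.

Lemma dprodDE c d i : (c + d) i = c i + d i.
Proof. by rewrite ffunE. Qed.
Lemma dprodZE a c i : (a *: c) i = a *: c i.
Proof. by rewrite ffunE. Qed.
Lemma dprod0E i : (0 : dprod) i = 0.
Proof. by rewrite ffunE. Qed.

End DependentProduct.

Section Cech.
Variables (A : comNzRingType) (n : nat) (y : 'I_n -> A) (M : lmodType A).

(* The multiplicative set generated by the y_k with k in S, so that localizing
   at it gives M_{y_S}, y_S being the product of these y_k. *)
Definition cech_den (S : {set 'I_n}) : {pred A} :=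
  [pred w | `[< exists e : 'I_n -> nat, w = \prod_(k in S) y k ^+ e k >]].

Fact cech_den_mulr_closed S : mulr_closed (cech_den S).
Proof.
split; first by apply/asboolP; exists (fun=> 0%N); rewrite big1.
move=> _ _ /asboolP[e ->] /asboolP[f ->]; apply/asboolP.
exists (fun k => (e k + f k)%N); rewrite -big_split.
by apply: eq_bigr => k _; rewrite exprD.
Qed.

HB.instance Definition _ S :=
  GRing.isMulClosed.Build A (cech_den S) (cech_den_mulr_closed S).

Lemma cech_den_sub (S T : {set 'I_n}) :
  S \subset T -> {subset cech_den S <= cech_den T}.
Proof.
move=> sST _ /asboolP[e ->]; apply/asboolP.
exists (fun k => if k \in S then e k else 0%N).
rewrite [RHS](big_setID S) /= (finset.setIidPr sST) [X in _ = _ * X]big1 ?mulr1.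
  by apply: eq_bigr => k kS; rewrite kS.
by move=> k; rewrite inE => /andP[/negPf-> _]; rewrite expr0.
Qed.

(* All the terms of the Cech complex at once: the degree p term is the submodule
   of cochains supported on the S with #|S| = p. *)
Definition cochain := dprod (fun S : {set 'I_n} => loc (cech_den S) M).

Definition cech_res (S : {set 'I_n}) k :
    loc (cech_den (S :\ k)%SET) M -> loc (cech_den S) M :=
  loc_map (cech_den_sub (subD1set S k)).

Definition cech_d (c : cochain) : cochain :=
  [ffun S : {set 'I_n} => \sum_(k in S)
    (-1) ^+ #|[set l in S | (l < k)%N]%SET| *: cech_res (c (S :\ k)%SET)].

Fact cech_d_is_linear : linear cech_d.
Proof.
move=> a c d; apply/ffunP=> S; rewrite dprodDE dprodZE !ffunE.
rewrite scaler_sumr -big_split; apply: eq_bigr => k _ /=.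
by rewrite dprodDE dprodZE /cech_res linearP scalerDr !scalerA [_ * a]mulrC.
Qed.

HB.instance Definition _ := GRing.isLinear.Build A cochain cochain *:%R cech_d
  cech_d_is_linear.

Definition in_degree (p : nat) (c : cochain) : Prop :=
  forall S : {set 'I_n}, #|S| <> p -> c S = 0.

Lemma in_degree_lin p a c d :
  in_degree p c -> in_degree p d -> in_degree p (a *: c + d).
Proof.
by move=> hc hd S Sp; rewrite dprodDE dprodZE hc // hd // scaler0 addr0.
Qed.

Lemma in_degree0 p : in_degree p 0.
Proof. by move=> S _; rewrite dprod0E. Qed.

Definition cocycle (p : nat) : {pred cochain} :=
  [pred c | `[< in_degree p c /\ cech_d c = 0 >]].

Fact cocycle_submod_closed p : submod_closed (cocycle p).
Proof.
split; first by apply/asboolP; split; [exact: in_degree0 | rewrite linear0].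
move=> a c d /asboolP[hc dc] /asboolP[hd dd]; apply/asboolP; split.
  exact: in_degree_lin.
by rewrite linearP /= dc dd scaler0 addr0.
Qed.

HB.instance Definition _ p :=
  GRing.isSubmodClosed.Build A cochain (cocycle p) (cocycle_submod_closed p).

Definition cocycles (p : nat) : Type := {c : cochain | c \in cocycle p}.
HB.instance Definition _ p := SubChoice.on (cocycles p).
HB.instance Definition _ p :=
  [SubChoice_isSubLmodule of cocycles p by <:].

(* The condition on c says that it is a (p - 1)-cochain, and that it is 0 if
   p = 0. *)
Definition boundary (p : nat) : {pred cocycles p} :=
  [pred z | `[< exists c : cochain,
     (forall S : {set 'I_n}, #|S|.+1 <> p -> c S = 0) /\ val z = cech_d c >]].

Arguments boundary p : clear implicits.

Fact boundary_submod_closed p : submod_closed (boundary p).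
Proof.
split.
  by apply/asboolP; exists 0; split=> [S _|]; rewrite ?dprod0E ?linear0.
move=> a z w /asboolP[c [hc zc]] /asboolP[d [hd wd]]; apply/asboolP.
exists (a *: c + d); split=> [S Sp|].
  by rewrite dprodDE dprodZE hc // hd // scaler0 addr0.
by rewrite !linearP /= zc wd.
Qed.

HB.instance Definition _ p := GRing.isSubmodClosed.Build A (cocycles p)
  (boundary p) (boundary_submod_closed p).

Definition cech_cohomology (p : nat) : lmodType A := modquot (boundary p).

End Cech.

Arguments boundary {A n} y M p.

(* A grading of an additive group V by Z x Z is given by its components
   i j |-> V_(i,j), as subsets of V. *)
Section BigradedCech.
Variables (A : comNzRingType) (n : nat) (y : 'I_n -> A) (M : lmodType A).
Variables (grA : int -> int -> A -> Prop) (grM : int -> int -> M -> Prop).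

Definition loc_piece (W : mulrClosed A) (i j : int) (q : loc W M) : Prop :=
  exists (a : M) (w : {w : A | w \in W}) (i' j' : int),
    [/\ grA i' j' (sval w), grM (i + i') (j + j') a & q = loc_frac a w].

Definition cech_piece (p : nat) (i j : int) (h : cech_cohomology y M p) : Prop :=
  exists z : cocycles y M p,
    (forall S, loc_piece i j (val z S)) /\ h = modq_pi (boundary y M p) z.

End BigradedCech.

Section BigradedPolynomials.
Variables (K : fieldType) (m n : nat).

Definition P0 : comNzRingType := {mpoly K[m]}.
Definition P : comNzRingType := {mpoly P0[n]}.

Definition bihomog (i j : int) (p : P) : Prop :=
  forall (b : 'X_{1..n}) (a : 'X_{1..m}),
    (p@_b : {mpoly K[m]})@_a != 0 -> (mdeg a)%:Z = i /\ (mdeg b)%:Z = j.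

Definition bihomogeneous (p : P) : Prop := exists i j : int, bihomog i j p.

(* K acts on a P-module through the constant polynomials. *)
Definition scalarP (c : K) : P := (c%:MP : {mpoly K[m]})%:MP.

Definition varY (k : 'I_n) : P := 'X_k.

Section Module.
Variables (M : lmodType P) (grM : int -> int -> M -> Prop).

(* H^p_{P_+}(M), as the cohomology of the Cech complex of M on y_1, ..., y_n. *)
Definition local_cohomology (p : nat) : lmodType P := cech_cohomology varY M p.

(* local_cohomology_piece p j is the P_0-module H^p_{P_+}(M)_j, graded by
   i |-> H^p_{P_+}(M)_(i,j). *)
Definition local_cohomology_piece (p : nat) (j i : int) :
    local_cohomology p -> Prop :=
  cech_piece bihomog grM i j.

End Module.

Section Hilbert.
Variable V : lmodType P.

Definition is_basis (U : V -> Prop) (d : nat) (v : 'I_d -> V) : Prop :=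
  (forall k, U (v k)) /\
  (forall u, U u -> exists! c : 'rV[K]_d,
     u = \sum_(k < d) scalarP (c ord0 k) *: v k).

(* Dimension of a K-subspace U of V; junk value 0 in infinite dimension. *)
Definition dimK (U : V -> Prop) : nat :=
  xget 0%N [set d | exists v : 'I_d -> V, is_basis U v]%classic.

(* The series with coefficients in nat and exponents in Z is identified with its
   coefficient function. *)
Definition Hilb (N : int -> V -> Prop) : int -> nat := fun i => dimK (N i).

End Hilbert.

Definition Hilb_le (F G : int -> nat) : Prop := forall i, (F i <= G i)%N.

Section Hypersurface.
Variable f : P.

Definition principal : {pred P^o} := [pred g | `[< exists q : P, g = q * f >]].

Fact principal_submod_closed : submod_closed principal.
Proof.
split; first by apply/asboolP; exists 0; rewrite mul0r.
move=> a _ _ /asboolP[q ->] /asboolP[r ->]; apply/asboolP.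
by exists (a * q + r); rewrite mulrDl -mulrA.
Qed.

HB.instance Definition _ :=
  GRing.isSubmodClosed.Build P P^o principal principal_submod_closed.

Definition hypersurface : lmodType P := modquot principal.

Definition hypersurface_piece (i j : int) (r : hypersurface) : Prop :=
  exists p : P, bihomog i j p /\ r = modq_pi principal p.

End Hypersurface.

End BigradedPolynomials.

(* Main.v *)
Require Import Defs.
From HB Require Import structures.
From mathcomp Require Import all_boot all_order all_algebra.
From mathcomp Require Import boolp classical_sets.
From mathcomp Require Import mpoly.

Import Order.TTheory GRing.Theory Num.Theory.
Local Open Scope ring_scope.

(** Multiplication by a variable [y_k] maps [H^n_{P_+}(R)_{j-1}] onto
    [H^n_{P_+}(R)_j] and preserves the [x]-degree, which gives the inequality of
    dimensions. The reason is visible on the Cech complex: every cochain of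
    degree [n] is a cocycle, so a top class is the class of a single fraction
    [a / w] of the localization at all the variables, and such a fraction is
    [y_k] times [a / (y_k w)], whose class lies one degree lower
    ([mul_top_piece_surj]).

    Since [dimK] takes a junk value in infinite dimension, the comparison also
    needs the source of the surjection to be finite-dimensional. A class of
    bidegree [(i, j)] is a [K]-combination of classes of fractions
    [x^a y^b / y^e]. If [b <= e], cancelling leaves [x^a / y^(e - b)] with
    [|a| = i] and [|e - b| = - j], of which there are finitely many; otherwise
    some [y_k] cancels from the denominator, so that the fraction comes from the
    localization at the other variables and its class is a coboundary
    ([top_class_res], [mon_span_piece]). *)

(** * Fractions *)

Section Fractions.
Set Implicit Arguments.
Unset Strict Implicit.
Unset Printing Implicit Defensive.
Variables (A : comNzRingType) (M : lmodType A) (W : mulrClosed A).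
Implicit Types (a b : M) (v w : {w : A | w \in W}).

Lemma loc_frac_linear c a b w :
  loc_frac (c *: a + b) w = c *: loc_frac a w + loc_frac b w.
Proof.
rewrite loc_scalefE loc_addfE; apply/loc_fracP; exists 1; rewrite rpred1.
by split=> //=; rewrite !scale1r -scalerDr scalerA.
Qed.

Lemma loc_frac_cancel s a v w :
  sval v = s * sval w -> loc_frac (s *: a) v = loc_frac a w.
Proof.
move=> vE; apply/loc_fracP; exists 1; rewrite rpred1 !scale1r scalerA vE.
by rewrite mulrC.
Qed.

End Fractions.

(** * Cohomology classes in top Cech degree *)

Section TopDegree.
Set Implicit Arguments.
Unset Strict Implicit.
Unset Printing Implicit Defensive.
Variables (A : comNzRingType) (n : nat) (y : 'I_n -> A) (M : lmodType A).

Local Notation face S := (loc (cech_den y S) M).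
Local Notation top := [set: 'I_n]%SET.

Definition on_face (S : {set 'I_n}) (q : face S) : cochain y M :=
  [ffun T : {set 'I_n} => dfwith (fun T => 0 : face T) q T].

Lemma on_face_in S (q : face S) : on_face q S = q.
Proof. by rewrite ffunE dfwith_in. Qed.

Lemma on_face_out S (q : face S) T : S != T -> on_face q T = 0.
Proof. by move=> ST; rewrite ffunE dfwith_out. Qed.

Lemma in_degree_neq_top (c : cochain y M) :
  in_degree n c <-> forall S, top != S -> c S = 0.
Proof.
have cardE (S : {set 'I_n}) : (#|S| == n) = (top == S).
  rewrite [RHS]eq_sym eqEcard finset.subsetT cardsT card_ord eqn_leq.
  by rewrite -[X in (_ <= X)%N](card_ord n) max_card.
split=> h S.
  by rewrite -cardE => /eqP; apply: h.
by move/eqP; rewrite cardE; apply: h.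
Qed.

(** A face contributing to the differential of [c] has fewer than [n] elements,
    and [c] vanishes there. *)
Lemma cech_d_top (c : cochain y M) : in_degree n c -> cech_d c = 0.
Proof.
move=> hc; apply/ffunP=> S; rewrite ffunE dprod0E big1 // => k kS.
rewrite hc ?[cech_res _]linear0 ?scaler0 // => e.
by have := max_card S; rewrite card_ord (cardsD1 k S) kS e ltnn.
Qed.

Fact on_top_cocycle (q : face top) : on_face q \in cocycle n.
Proof.
have hq : in_degree n (on_face q).
  by apply/in_degree_neq_top => S /on_face_out->.
by apply/asboolP; split=> //; apply: cech_d_top.
Qed.

Definition top_cocycle (q : face top) : cocycles y M n :=
  exist _ (on_face q) (on_top_cocycle q).

Definition top_class (q : face top) : cech_cohomology y M n :=
  modq_pi (boundary y M n) (top_cocycle q).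

Fact top_cocycle_is_linear : linear top_cocycle.
Proof.
move=> a q r; apply: val_inj; rewrite linearP /=.
apply/ffunP=> S; rewrite dprodDE dprodZE.
have [<-|ST] := eqVneq top S; first by rewrite !on_face_in.
by rewrite !on_face_out // scaler0 addr0.
Qed.

HB.instance Definition _ :=
  GRing.isLinear.Build A (face top) (cocycles y M n) *:%R top_cocycle
    top_cocycle_is_linear.

Fact top_class_is_linear : linear top_class.
Proof. by move=> a q r; rewrite /top_class !linearP. Qed.

HB.instance Definition _ :=
  GRing.isLinear.Build A (face top) (cech_cohomology y M n) *:%R top_class
    top_class_is_linear.

Lemma top_cocycleE (z : cocycles y M n) : z = top_cocycle (val z top).
Proof.
apply: val_inj; apply/ffunP=> S /=.
have [<-|ST] := eqVneq top S; first by rewrite on_face_in.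
have /asboolP[/in_degree_neq_top-> //] := valP z.
by rewrite on_face_out.
Qed.

(** Up to sign, [q] itself is a cochain of degree [n - 1] with this
    coboundary: the only face with one element more than the complement of [k] is
    the top one. *)
Lemma top_class_res k (q : face (top :\ k)%SET) : top_class (cech_res q) = 0.
Proof.
rewrite /top_class -(linear0 (modq_pi (boundary y M n))).
apply/modq_piP; rewrite subr0; apply/asboolP.
set s := (-1) ^+ #|[set l in top | (l < k)%N]%SET| : A.
have ss : s * s = 1 by rewrite -expr2 sqrr_sign.
have cT : #|(top :\ k)%SET|.+1 = n.
  by have := cardsD1 k top; rewrite cardsT card_ord finset.in_setT add1n => /esym.
have hc (S : {set 'I_n}) : #|S|.+1 <> n -> on_face (s *: q) S = 0.
  by move=> Sn; apply: on_face_out; apply/eqP=> e; case: Sn; rewrite -e.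
exists (on_face (s *: q)); split=> //=.
apply/ffunP=> S; rewrite [RHS]ffunE.
have [<-|ST] := eqVneq top S.
  rewrite on_face_in (bigD1 k) ?finset.in_setT //= big1 => [|l /andP[_ lk]].
    by rewrite on_face_in /cech_res linearZ /= scalerA ss scale1r addr0.
  rewrite on_face_out ?[cech_res _]linear0 ?scaler0 //.
  by apply/eqP=> /setP/(_ l); rewrite !inE eqxx lk.
rewrite on_face_out // big1 // => l lS.
rewrite hc ?[cech_res _]linear0 ?scaler0 // => e; case/eqP: ST; apply/esym/eqP.
by rewrite eqEcard finset.subsetT cardsT card_ord (cardsD1 l S) lS add1n e leqnn.
Qed.

Lemma top_class_frac0 k a (w : {w : A | w \in cech_den y top}) :
  sval w \in cech_den y (top :\ k)%SET -> top_class (loc_frac a w) = 0.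
Proof.
pose D := cech_den y (top :\ k)%SET; move=> wk.
pose w' : {w : A | w \in D} := exist _ (sval w) wk.
rewrite -(top_class_res (loc_frac a w')).
rewrite /cech_res loc_mapE; congr top_class; apply/loc_fracP.
by exists 1; rewrite rpred1.
Qed.

Lemma cech_den_mulS k (w : A) (S : {set 'I_n}) :
  k \in S -> w \in cech_den y S -> y k * w \in cech_den y S.
Proof.
move=> kS wS; apply: rpredM => //; apply/asboolP.
exists (fun l => nat_of_bool (l == k)).
rewrite (bigD1 k) //= eqxx expr1 big1 ?mulr1 // => l /andP[_ /negPf->].
by rewrite expr0.
Qed.

Variables (grA : int -> int -> A -> Prop) (grM : int -> int -> M -> Prop).

Lemma cech_piece_top i j (h : cech_cohomology y M n) : grA 0 0 1 -> grM i j 0 ->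
  cech_piece grA grM i j h <->
  exists q : face top, loc_piece grA grM i j q /\ h = top_class q.
Proof.
move=> gr1 gr0; split=> [[z [hz ->]]|[q [hq ->]]].
  by exists (val z top); split=> //; rewrite /top_class -top_cocycleE.
exists (top_cocycle q); split=> // S /=.
have [<-|ST] := eqVneq top S; first by rewrite on_face_in.
rewrite on_face_out //; exists 0, (den1 _), 0, 0; rewrite !addr0.
by split.
Qed.

(** A preimage of the class of [a / w] is the class of [a / (y k * w)]. *)
Lemma mul_top_piece_surj k i j (h : cech_cohomology y M n) :
    grA 0 0 1 -> grM i j 0 -> grM i (j - 1) 0 ->
    (forall i j w, grA i j w -> grA i (j + 1) (y k * w)) ->
  cech_piece grA grM i j h ->
  exists2 g : cech_cohomology y M n,
    cech_piece grA grM i (j - 1) g & h = y k *: g.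
Proof.
move=> gr1 gr0 gr0' gry /cech_piece_top[] // q [[a [w [i' [j' [grw gra ->]]]]] ->].
pose w' : {x | x \in cech_den y top} :=
  exist _ (y k * sval w) (cech_den_mulS (finset.in_setT k) (valP w)).
exists (top_class (loc_frac a w')).
  apply/cech_piece_top => //; exists (loc_frac a w'); split=> //.
  exists a, w', i', (j' + 1); split=> //; first exact: gry.
  by rewrite [j' + 1]addrC addrA subrK.
rewrite -linearZ /= loc_scalefE; congr top_class.
by apply/esym/loc_frac_cancel.
Qed.

End TopDegree.

(** * Dimensions of K-subspaces *)

Section Dimension.
Set Implicit Arguments.
Unset Strict Implicit.
Unset Printing Implicit Defensive.
Variables (K : fieldType) (m n : nat).

Local Notation toP := (@Defs.scalarP K m n).

Fact scalarP_is_zmod_morphism : zmod_morphism toP.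
Proof. by move=> a b; rewrite /Defs.scalarP !rmorphB. Qed.

Fact scalarP_is_monoid_morphism : monoid_morphism toP.
Proof. by split=> [|a b]; rewrite /Defs.scalarP ?rmorph1 ?rmorphM. Qed.

HB.instance Definition _ :=
  GRing.isZmodMorphism.Build K (P K m n) toP scalarP_is_zmod_morphism.
HB.instance Definition _ :=
  GRing.isMonoidMorphism.Build K (P K m n) toP scalarP_is_monoid_morphism.

Variable V : lmodType (P K m n).

Definition lincomb d (v : 'I_d -> V) (c : 'rV[K]_d) : V :=
  \sum_(k < d) toP (c ord0 k) *: v k.

Lemma lincombP d (v : 'I_d -> V) a c c' :
  lincomb v (a *: c + c') = toP a *: lincomb v c + lincomb v c'.
Proof.
rewrite scaler_sumr -big_split; apply: eq_bigr => k _ /=.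
by rewrite !mxE rmorphD rmorphM scalerDl scalerA.
Qed.

Lemma lincomb0 d (v : 'I_d -> V) : lincomb v 0 = 0.
Proof. by rewrite /lincomb big1 // => k _; rewrite mxE rmorph0 scale0r. Qed.

Lemma lincomb_delta d (v : 'I_d -> V) k : lincomb v (delta_mx ord0 k) = v k.
Proof.
rewrite /lincomb (bigD1 k) //= mxE !eqxx rmorph1 scale1r big1 ?addr0 // => l lk.
by rewrite mxE (negPf lk) andbF rmorph0 scale0r.
Qed.

Lemma lincombM d e (v : 'I_e -> V) (B : 'M_(d, e)) c :
  lincomb v (c *m B) = lincomb (fun k => lincomb v (row k B)) c.
Proof.
rewrite /lincomb; under [RHS]eq_bigr do rewrite scaler_sumr.
rewrite exchange_big; apply: eq_bigr => l _ /=.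
rewrite mxE rmorph_sum scaler_suml; apply: eq_bigr => k _.
by rewrite mxE rmorphM scalerA.
Qed.

(** A spanning family of elements of [U] that satisfies a linear relation still
    spans [U] once a member with nonzero coefficient is dropped. *)
Lemma exists_basis (U : V -> Prop) N (w : 'I_N -> V) :
  (forall k, U (w k)) -> (forall u, U u -> exists c, u = lincomb w c) ->
  exists d (v : 'I_d -> V), is_basis U v.
Proof.
elim: N w => [|N IH] w Uw spanw.
  exists 0%N, w; split=> // u /spanw[c uc]; exists c; split=> // c' _.
  by apply/matrixP=> i [].
have [uniq|/existsNP[e /not_implyP[e0 /eqP enz]]] :=
    pselect (forall e, lincomb w e = 0 -> e = 0).
  exists N.+1, w; split=> // u /spanw[c uc]; exists c; split=> // c' uc'.
  apply/eqP; rewrite -subr_eq0; apply/eqP/uniq.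
  rewrite addrC -scaleN1r lincombP -[lincomb w c]uc -[lincomb w c']uc'.
  by rewrite rmorphN1 scaleN1r addNr.
have /rV0Pn[k ek] := enz.
apply: (IH (w \o lift k)) => [l|u /spanw[c ->]]; first exact: Uw.
(* [e] expresses [w k] through the other vectors. *)
pose c' := (- (c ord0 k / e ord0 k)) *: e + c.
have c'k : c' ord0 k = 0 by rewrite !mxE mulNr divfK // addNr.
exists (\row_l c' ord0 (lift k l)).
have -> : lincomb w c = lincomb w c' by rewrite lincombP e0 scaler0 add0r.
rewrite /lincomb (bigD1_ord k) //= c'k rmorph0 scale0r add0r.
by apply: eq_bigr => l _; rewrite mxE.
Qed.

(** Lifting a basis of [U] to [U'] and writing the lifts in a basis of [U']
    gives a [d] by [d'] matrix. If [d' < d], a nonzero row vector kills it, hence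
    is a relation on the basis of [U]. *)
Lemma basis_size_le (U U' : V -> Prop) (a : P K m n) d d'
    (v : 'I_d -> V) (v' : 'I_d' -> V) :
    (forall u, U u -> exists2 u', U' u' & u = a *: u') ->
  is_basis U v -> is_basis U' v' -> (d <= d')%N.
Proof.
move=> surj [Uv basv] [_ basv']; rewrite leqNgt; apply/negP=> dd'.
have /choice[r rP] k : exists c, v k = lincomb (fun l => a *: v' l) c.
  have [u' /basv'[c [uc _]] ->] := surj _ (Uv k).
  exists c; rewrite uc scaler_sumr; apply: eq_bigr => l _.
  by rewrite !scalerA mulrC.
pose B := \matrix_k r k.
have : kermx B != 0.
  rewrite kermx_eq0 /row_free neq_ltn (leq_ltn_trans _ dd') //.
  exact: rank_leq_col.
case/rowV0Pn=> c /sub_kermxP cB cnz.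
have vc : lincomb v c = 0.
  rewrite -(lincomb0 (fun l => a *: v' l)) -cB lincombM.
  by apply: eq_bigr => k _; rewrite rowK -rP.
pose k := Ordinal (leq_ltn_trans (leq0n d') dd').
have [c0 [_ uniq]] := basv _ (Uv k).
have e1 := uniq _ (esym (lincomb_delta v k)).
have e2 : c0 = c + delta_mx ord0 k.
  apply: uniq; have := lincombP v 1 c (delta_mx ord0 k).
  by rewrite scale1r vc scaler0 add0r lincomb_delta => /esym.
by case/eqP: cnz; apply: (addIr (delta_mx ord0 k)); rewrite add0r -e2.
Qed.

(** The finite spanning family [w] of [U'] excludes the junk value of
    [dimK U']; when [dimK U] is junk, it is [0]. *)
Lemma dimK_le_of_surj (U U' : V -> Prop) (a : P K m n) N (w : 'I_N -> V) :
    (forall k, U' (w k)) -> (forall u, U' u -> exists c, u = lincomb w c) ->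
    (forall u, U u -> exists2 u', U' u' & u = a *: u') ->
  (dimK U <= dimK U')%N.
Proof.
move=> Uw spanw surj; rewrite [X in (X <= _)%N]/dimK.
case: xgetP => [d _ [v bv]|//].
rewrite /dimK; case: xgetP => [d' _ [v' bv']|no].
  exact: basis_size_le surj bv bv'.
by have [d' bd'] := exists_basis Uw spanw; case: (no d').
Qed.

End Dimension.

(** * Monomial generators of top local cohomology *)

Section Monomials.
Set Implicit Arguments.
Unset Strict Implicit.
Unset Printing Implicit Defensive.
Variables (K : fieldType) (m n : nat).

Local Notation y := (@varY K m n).
Local Notation top := [set: 'I_n]%SET.

Definition ymon (e : 'X_{1..n}) : P K m n := 'X_[P0 K m, e].
Definition xmon (a : 'X_{1..m}) : P K m n := ('X_[K, a])%:MP.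

Lemma ymonD e e' : ymon (e + e')%MM = ymon e * ymon e'.
Proof. exact: mpolyXD. Qed.

Lemma ymon_den (S : {set 'I_n}) (e : 'X_{1..n}) :
  (forall k, k \notin S -> e k = 0%N) -> ymon e \in cech_den y S.
Proof.
move=> eS; apply/asboolP; exists e; rewrite /ymon mpolyXE_id.
rewrite (bigID (mem S)) /= [X in _ * X]big1 ?mulr1 // => k kS.
by rewrite eS // expr0.
Qed.

Definition yden (e : 'X_{1..n}) : {w : P K m n | w \in cech_den y top} :=
  exist _ (ymon e) (ymon_den (fun k (kS : k \notin top) =>
    False_ind _ (negP kS (finset.in_setT k)))).

Lemma yden_exists (w : {w : P K m n | w \in cech_den y top}) :
  exists e, w = yden e.
Proof.
have /asboolP[e we] := valP w.
exists [multinom e k | k < n]; apply: val_inj; rewrite we /= /ymon mpolyXE_id.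
rewrite big_mkcond; apply: eq_bigr => k _.
by rewrite finset.in_setT mnmE.
Qed.

Lemma bihomog0 i j : bihomog i j (0 : P K m n).
Proof. by move=> b a; rewrite !mcoeff0 eqxx. Qed.

Lemma bihomog_ymon e : bihomog 0 (mdeg e)%:Z (ymon e).
Proof.
move=> b a; rewrite /ymon mcoeffX.
have [<-|_] := eqVneq e b; last by rewrite mcoeff0 eqxx.
rewrite mcoeff1; have [->|_] := eqVneq a 0%MM; last by rewrite eqxx.
by rewrite mdeg0.
Qed.

Lemma bihomog_xmon a : bihomog (mdeg a)%:Z 0 (xmon a).
Proof.
move=> b c; rewrite /xmon mcoeffC.
have [->|_] := eqVneq b 0%MM; last by rewrite mulr0 mcoeff0 eqxx.
rewrite mulr1 mcoeffX mdeg0; have [<-//|_] := eqVneq a c.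
by rewrite eqxx.
Qed.

Lemma bihomog_varM k i j (p : P K m n) :
  bihomog i j p -> bihomog i (j + 1) (y k * p).
Proof.
move=> hp b a; rewrite /varY mcoeffM raddf_sum => /eqP nz.
have [b1 [b2 [->]]] : exists b1 b2 : 'X_{1..n},
    b = (b1 + b2)%MM /\ (('X_k : P K m n)@_b1 * p@_b2)@_a != 0.
  apply: contra_notP nz => no; apply: big1 => c /eqP bc.
  by apply/eqP/negPn/negP => nz; apply: no; exists c.1, c.2.
rewrite mcoeffX; have [<-|_] := eqVneq U_(k)%MM b1.
  by rewrite mul1r => /hp[-> <-]; rewrite mdegD mdeg1 PoszD addrC.
by rewrite mul0r mcoeff0 eqxx.
Qed.

Lemma mpoly_xyE (p : P K m n) :
  p = \sum_(b <- msupp p) \sum_(a <- msupp p@_b)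
        Defs.scalarP m n (p@_b)@_a * (ymon b * xmon a).
Proof.
rewrite {1}[p]mpolyE; apply: eq_bigr => b _.
rewrite {1}[p@_b]mpolyE scaler_suml; apply: eq_bigr => a _.
by rewrite -mul_mpolyC -mul_mpolyC rmorphM /= -mulrA [ymon b * _]mulrC.
Qed.

Variable f : P K m n.

Local Notation R := (hypersurface f).

Definition frac_class e (p : (P K m n)^o) : local_cohomology R n :=
  top_class (loc_frac (modq_pi (principal f) p) (yden e)).

Fact frac_class_is_linear e : linear (frac_class e).
Proof.
by move=> c p q; rewrite /frac_class linearP loc_frac_linear linearP.
Qed.

HB.instance Definition _ e :=
  GRing.isLinear.Build (P K m n) (P K m n)^o (local_cohomology R n) *:%R
    (frac_class e) (frac_class_is_linear e).

Lemma frac_class_cancel b e p :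
  frac_class (b + e)%MM (ymon b * p) = frac_class e p.
Proof.
have pM : modq_pi (principal f) (ymon b * p) = ymon b *: modq_pi (principal f) p.
  exact: linearZ.
rewrite /frac_class pM; congr top_class; apply: loc_frac_cancel.
exact: ymonD.
Qed.

(** Without [y_k] in the denominator, the fraction comes from the face that
    omits [k]. *)
Lemma frac_class_pole0 k (e : 'X_{1..n}) p : e k = 0%N -> frac_class e p = 0.
Proof.
move=> ek; apply: (top_class_frac0 (k := k)).
by apply: ymon_den => l; rewrite !inE andbT negbK => /eqP->.
Qed.

Local Notation piece j i :=
  (local_cohomology_piece (hypersurface_piece (f := f)) (p := n) j i).

Lemma hypersurface_piece0 i j : hypersurface_piece i j (0 : R).
Proof. by exists 0; split; [exact: bihomog0 | rewrite linear0]. Qed.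

Lemma bihomog1 : bihomog 0 0 (1 : P K m n).
Proof. by have := @bihomog_ymon 0%MM; rewrite mdeg0 /ymon mpolyX0. Qed.

Lemma piece0 j i : piece j i 0.
Proof.
apply/cech_piece_top; [exact: bihomog1|exact: hypersurface_piece0|].
exists 0; rewrite linear0; split=> //.
exists 0, (den1 _), 0, 0; split=> //; first exact: bihomog1.
exact: hypersurface_piece0.
Qed.

Lemma piece_frac_class i (e : 'X_{1..n}) (p : P K m n) :
  bihomog i 0 p -> piece (- (mdeg e)%:Z) i (frac_class e p).
Proof.
move=> hp; apply/cech_piece_top; [exact: bihomog1|exact: hypersurface_piece0|].
exists (loc_frac (modq_pi (principal f) p) (yden e)); split=> //.
exists (modq_pi (principal f) p), (yden e), 0, (mdeg e)%:Z.
split=> //; first exact: bihomog_ymon.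
by rewrite addr0 addNr; exists p.
Qed.

Section Generators.
Variables i j : int.

Local Notation index :=
  ('X_{1..m < `|i|.+1} * 'X_{1..n < `|j|.+1})%type.

(** The index type only bounds the exponents; the tests on the degrees put every
    member of the family in bidegree [(i, j)]. *)
Definition mon_class (t : index) : local_cohomology R n :=
  if ((mdeg t.1)%:Z == i) && ((mdeg t.2)%:Z == - j)
  then frac_class t.2 (xmon t.1) else 0.

Lemma piece_mon_class t : piece j i (mon_class t).
Proof.
case: t => -[a ha] [e he]; rewrite /mon_class /= {ha he}.
case: andP => [[/eqP<- /eqP tj]|_]; last exact: piece0.
rewrite -[j]opprK -tj; apply: piece_frac_class; exact: bihomog_xmon.
Qed.

Definition mon_family (k : 'I_#|{: index}|) := mon_class (enum_val k).

Definition mon_span (u : local_cohomology R n) : Prop :=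
  exists c, u = lincomb mon_family c.

Lemma mon_span0 : mon_span 0.
Proof. by exists 0; rewrite lincomb0. Qed.

Lemma mon_spanD u v : mon_span u -> mon_span v -> mon_span (u + v).
Proof.
by move=> [c ->] [d ->]; exists (1 *: c + d); rewrite lincombP rmorph1 scale1r.
Qed.

Lemma mon_spanZ a u : mon_span u -> mon_span (Defs.scalarP m n a *: u).
Proof.
by move=> [c ->]; exists (a *: c + 0); rewrite lincombP lincomb0 addr0.
Qed.

Lemma mon_span_mon (a : 'X_{1..m}) (e : 'X_{1..n}) :
  (mdeg a)%:Z = i -> (mdeg e)%:Z = - j -> mon_span (frac_class e (xmon a)).
Proof.
move=> ai ej.
have ha : (mdeg a < `|i|.+1)%N by rewrite -ai.
have he : (mdeg e < `|j|.+1)%N by rewrite -abszN -ej.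
pose t : index := (BMultinom ha, BMultinom he).
have <- : mon_class t = frac_class e (xmon a) by rewrite /mon_class /= ai ej !eqxx.
by exists (delta_mx ord0 (enum_rank t)); rewrite lincomb_delta /mon_family enum_rankK.
Qed.

Lemma mon_span_frac (e : 'X_{1..n}) (p : P K m n) :
  bihomog i (j + (mdeg e)%:Z) p -> mon_span (frac_class e p).
Proof.
move=> hp; rewrite [p]mpoly_xyE linear_sum big_seq.
apply: big_ind => [||b _]; [exact: mon_span0|exact: mon_spanD|].
rewrite linear_sum big_seq.
apply: big_ind => [||a]; [exact: mon_span0|exact: mon_spanD|].
rewrite mcoeff_msupp => /hp[ai bj].
suff : mon_span (Defs.scalarP m n (p@_b)@_a *: frac_class e (ymon b * xmon a)).
  by rewrite -linearZ.
apply: mon_spanZ.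
have [/submK be|nbe] := boolP (b <= e)%MM.
  rewrite -be addmC frac_class_cancel; apply: mon_span_mon => //.
  have degE : (mdeg e)%:Z = (mdeg (e - b)%MM)%:Z + (mdeg b)%:Z.
    by rewrite -PoszD -mdegD be.
  move: bj; rewrite degE addrA -[X in X = _]add0r => /addIr/esym/eqP.
  by rewrite addrC addr_eq0 => /eqP.
have [k ebk] : exists k, (e k < b k)%N.
  apply/existsP; apply: contraNT nbe => /existsPn h; apply/mnm_lepP => k.
  by rewrite leqNgt.
(* Cancelling [y_k ^ e k] leaves a denominator without [y_k]. *)
pose u := (U_(k) *+ e k)%MM.
have uE (l : 'I_n) : u l = if l == k then e k else 0%N.
  by rewrite mulmnE mnm1E eq_sym; case: eqP => _; rewrite ?mul1n ?mul0n.
have /submK eE : (u <= e)%MM.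
  by apply/mnm_lepP => l; rewrite uE; case: eqP => [->|].
have /submK bE : (u <= b)%MM.
  by apply/mnm_lepP => l; rewrite uE; case: eqP => [->|//]; apply: ltnW.
rewrite -eE -bE addmC [(_ - _ + _)%MM]addmC ymonD -mulrA frac_class_cancel.
rewrite (frac_class_pole0 (k := k)); first exact: mon_span0.
by rewrite mnmBE uE eqxx subnn.
Qed.

Lemma mon_span_piece u : piece j i u -> mon_span u.
Proof.
case/(cech_piece_top _ bihomog1 (hypersurface_piece0 i j)).
move=> q [[_ [w [i' [j' [grw [p [hp ->]] ->]]]]] ->].
have [e we] := yden_exists w; rewrite we in grw *.
have [i0 j0] : (0 : int) = i' /\ (mdeg e)%:Z = j'.
  have := grw e 0%MM; rewrite /= /ymon mcoeffX eqxx mcoeff1 eqxx mdeg0.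
  by apply; rewrite oner_neq0.
by rewrite -i0 -j0 addr0 in hp; apply: mon_span_frac.
Qed.

End Generators.
End Monomials.

Theorem theorem3p3 (K : fieldType) (m n : nat) (hn : (0 < n)%N)
    (f : P K m n) (hf : bihomogeneous f) (j : int) (hj : j <= - n%:Z) :
  let H := local_cohomology_piece (@hypersurface_piece K m n f) (p := n) in
  Hilb_le (Hilb (H j)) (Hilb (H (j - 1))).
Proof.
move=> H i; rewrite /Hilb.
apply: (dimK_le_of_surj (a := varY K m (Ordinal hn))
  (w := @mon_family K m n f i (j - 1))).
- by move=> k; apply: piece_mon_class.
- exact: mon_span_piece.
move=> u; apply: mul_top_piece_surj.
- exact: bihomog1.
- exact: hypersurface_piece0.
- exact: hypersurface_piece0.
- by move=> i' j' p; apply: bihomog_varM.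
Qed.
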